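(* Let $(G,\mathcal{C},\mathrm{color})$ be an edge-colored graph of order $n$. Let $g$ and $f$ be mappings from $\mathcal{C}$ to $\mathbb{Z}_{\ge 0}$ such that $g(c)\le f(c)$ for every $c\in\mathcal{C}$. Let $m$ be a positive integer such that $n\ge m+\sum_{c\in\mathcal{C}}g(c)$. Then $G$ has a $(g,f)$-chromatic spanning forest with exactly $m$ components if and only if, for every $R\subseteq\mathcal{C}$, $$\omega(G-E_R(G))\le \min\Big\{\, m+\sum_{c\in R}f(c),\ \ n-\sum_{c\in\mathcal{C}\setminus R}g(c)\,\Big\}.$$
   Context: Graphs are finite, undirected, without loops or multiple edges; the order of a graph is its number of vertices. An edge-colored graph is a triple $(G,\mathcal{C},\mathrm{color})$ where $G$ is a graph, $\mathcal{C}$ is a set of colors and $\mathrm{color}:E(G)\to\mathcal{C}$ is an arbitrary mapping (the coloring need not be proper, and not every color need be used); it is abbreviated as $G$. Subgraphs of $G$ inherit the coloring and keep the same color set $\mathcal{C}$. For an edge-colored graph $H$ with color set $\mathcal{C}$, $R\subseteq\mathcal{C}$ and $c\in\mathcal{C}$, put $E_R(H)=\{e\in E(H): \mathrm{color}(e)\in R\}$ and $E_c(H)=E_{\{c\}}(H)$. $G-E_R(G)$ denotes the graph $(V(G),E(G)\setminus E_R(G))$. $\omega(H)$ denotes the number of connected components of $H$. An edge-colored graph $H$ with color set $\mathcal{C}$ is $(g,f)$-chromatic if $g(c)\le|E_c(H)|\le f(c)$ for every $c\in\mathcal{C}$. A spanning forest of $G$ is an acyclic subgraph with vertex set $V(G)$.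 Sums over subsets of $\mathcal{C}$ are taken in $\mathbb{Z}_{\ge0}\cup\{\infty\}$ (they are ordinary finite sums when $\mathcal{C}$ is finite). *)

(* Defs.v *)
From mathcomp Require Import all_boot all_order all_algebra.
From mathcomp Require Import boolp classical_sets reals ereal esum.

Set Implicit Arguments.
Unset Strict Implicit.
Unset Printing Implicit Defensive.

Record sgraph (V : finType) := SGraph {
  edges : {set {set V}};
  edges_card2 : forall e, e \in edges -> #|e| = 2 }.

Definition edge (V : finType) (G : sgraph V) : finType :=
  {e : {set V} | e \in edges G}.

(* The coloring is defined on E(G) only, so that an edgeless graph may have an
   empty color set. *)
Record ecgraph (V : finType) (C : Type) := ECGraph {
  ecgraph_graph :> sgraph V;
  color : edge ecgraph_graph -> C }.

Section Graphs.
Variables (V : finType) (G : sgraph V).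

Definition adj : rel V := [rel x y | [set x; y] \in edges G].

Definition omega : nat := n_comp adj predT.

(* [ucycle adj s] also holds for s empty and for s = [:: x; y] with xy an edge;
   the cycles of a simple graph are the ones with at least three vertices. *)
Definition acyclic : Prop := forall s : seq V, ucycle adj s -> size s <= 2.

End Graphs.

Section SpanningSubgraph.
Variables (V : finType) (C : Type) (G : ecgraph V C) (F : {set edge G}).

Lemma sub_edges_in (e : {set V}) :
  e \in [set val x | x in F] -> e \in edges G.
Proof. by case/imsetP => x _ ->; apply: valP. Qed.

Lemma sub_edges_card2 (e : {set V}) :
  e \in [set val x | x in F] -> #|e| = 2.
Proof. by move/sub_edges_in; apply: edges_card2. Qed.

Definition sub_sgraph : sgraph V := SGraph sub_edges_card2.

(* The graph (V(G), F) with the coloring inherited from G. *)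
Definition spanning_subgraph : ecgraph V C :=
  @ECGraph V C sub_sgraph
    (fun e => color (exist _ (val e) (sub_edges_in (valP e)) : edge G)).

End SpanningSubgraph.

Section Colors.
Variables (V : finType) (C : choiceType).

Definition edges_in (H : ecgraph V C) (R : set C) : {set edge H} :=
  [set e : edge H | color e \in R].

Definition chromatic (g f : C -> nat) (H : ecgraph V C) : Prop :=
  forall c : C, g c <= #|edges_in H [set c]%classic| <= f c.

Definition del_colors (G : ecgraph V C) (R : set C) : ecgraph V C :=
  spanning_subgraph (~: edges_in G R).

Definition is_spanning_forest (G : ecgraph V C) (F : {set edge G}) : Prop :=
  acyclic (spanning_subgraph F).

End Colors.

(* Main.v *)
Require Import Defs.
From mathcomp Require Import all_boot.
From mathcomp Require Import zify.

(* The rank n - omega of the graphic matroid turns the two bounds of the theorem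
   into rank conditions on the color classes: the second one is Rado's condition
   for a forest with g(c) edges of each color, and the first one bounds the size
   of the largest forest with at most f(c) edges of each color. By submodularity
   g can be raised, within f and without breaking Rado's condition, to some h of
   total n - m; a forest with exactly h(c) edges of each color c then has m
   components. *)

Set Implicit Arguments.
Unset Strict Implicit.
Unset Printing Implicit Defensive.

(** * Rado's theorem for a submodular rank function *)

Section MatroidRank.
Variables (T D : finType) (r : {set T} -> nat) (col : T -> D).

Hypothesis r_card : forall A, r A <= #|A|.
Hypothesis r_submod : forall A B, r (A :|: B) + r (A :&: B) <= r A + r B.

Local Notation colored E S := (E :&: col @^-1: S).

(** Submodularity on [B :\ x] and [A]: deleting x costs A at least as much rank as it costs B. *)
Lemma rank_coloop_sub (A B : {set T}) x :
  A \subset B -> x \in A -> r (B :\ x) < r B -> r (A :\ x) < r A.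
Proof.
move=> sAB Ax rx; have := r_submod (B :\ x) A.
have -> : (B :\ x) :|: A = B.
  apply/setP=> y; rewrite !inE; case: eqVneq => [->|_] /=.
    by rewrite Ax (subsetP sAB).
  by case: (boolP (y \in A)) => [/(subsetP sAB)->|_]; rewrite ?orbF.
have -> : (B :\ x) :&: A = A :\ x.
  by rewrite setIDAC; congr (_ :\ _); apply/setIidPr.
lia.
Qed.

(** By submodularity each x in A still costs rank once the rest of A is gone, so deleting A one
    element at a time loses at least one unit per element. *)
Lemma rank_coloops (A B : {set T}) :
    A \subset B -> {in A, forall x, r (B :\ x) < r B} ->
  #|A| + r (B :\: A) <= r B.
Proof.
have [n] := ubnP #|A|; elim: n A => // n IH A ltAn sAB coA.
have [->|[x Ax]] := set_0Vmem A; first by rewrite cards0 setD0.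
have sAxA := subsetDl A [set x].
have := IH (A :\ x); rewrite (cardsD1 x A) Ax in ltAn *.
move=> /(_ ltAn (subset_trans sAxA sAB) (fun y Ay => coA y (subsetP sAxA y Ay))).
have := r_submod (B :\ x) (B :\: (A :\ x)).
have -> : (B :\ x) :|: (B :\: (A :\ x)) = B.
  by rewrite -setDIr (_ : _ :&: _ = set0) ?setD0 //; apply/setP=> y; rewrite !inE; case: eqP.
have -> : (B :\ x) :&: (B :\: (A :\ x)) = B :\: A.
  by rewrite -setDUr setD1K.
have := coA x Ax; lia.
Qed.

Definition independent (F : {set T}) := r F = #|F|.

(** In this form independence passes to subsets and compares with acyclicity. The converse is
    [rank_coloops] with both sets equal to F. *)
Lemma independentP F :
  independent F <-> {in F, forall x, r (F :\ x) < r F}.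
Proof.
split=> [rF x Fx|coF].
  by have := r_card (F :\ x); rewrite rF (cardsD1 x F) Fx; lia.
by have := rank_coloops (subxx F) coF; have := r_card F; rewrite /independent; lia.
Qed.

Lemma independent_sub (A B : {set T}) :
  A \subset B -> independent B -> independent A.
Proof.
move=> sAB /independentP coB; apply/independentP=> x Ax.
exact: rank_coloop_sub sAB Ax (coB _ (subsetP sAB x Ax)).
Qed.

Lemma sum_setUI (h : D -> nat) (S S' : {set D}) :
  \sum_(d in S :|: S') h d + \sum_(d in S :&: S') h d =
  \sum_(d in S) h d + \sum_(d in S') h d.
Proof.
rewrite ![\sum_(d in _) _]big_mkcond -!big_split /=.
by apply: eq_bigr => d _; rewrite !inE; case: (d \in S); case: (d \in S'); rewrite /= ?addn0.
Qed.

Section Uncrossing.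
Variables (h : D -> nat) (E : {set T}).
Hypothesis leh : forall S : {set D}, \sum_(d in S) h d <= r (colored E S).

Definition tight (S : {set D}) := r (colored E S) == \sum_(d in S) h d.

(** The sum of h is modular and r is submodular, so equality at S and S' leaves no slack at their
    union and intersection. *)
Lemma tightUI S S' : tight S -> tight S' -> tight (S :|: S') && tight (S :&: S').
Proof.
rewrite /tight => /eqP tS /eqP tS'; have := r_submod (colored E S) (colored E S').
rewrite -setIUr -preimsetU setIACA setIid -preimsetI.
have := leh (S :|: S'); have := leh (S :&: S'); have := sum_setUI h S S'; lia.
Qed.

End Uncrossing.

Lemma card_color_sum (F : {set T}) (S : {set D}) :
  #|colored F S| = \sum_(d in S) #|colored F [set d]|.
Proof.
rewrite -sum1_card (partition_big col (mem S)) /=; last by move=> x; rewrite !inE => /andP[].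
apply: eq_bigr => d Sd; rewrite -sum1_card; apply: eq_bigl => x.
by rewrite !inE -andbA; case: eqP => [->|_]; rewrite ?Sd ?andbT ?andbF.
Qed.

(* In a minimal E satisfying the rank condition, each x in E lies in a tight set
   of colors for which x is a coloop. If a color d had more than h d edges, these
   would all be coloops for the smallest tight set containing d, which is then
   too small in rank without d. *)
Lemma rado_transversal (h : D -> nat) (E : {set T}) :
    (forall S : {set D}, \sum_(d in S) h d <= r (colored E S)) ->
  exists F : {set T}, independent F /\ forall d, #|colored F [set d]| = h d.
Proof.
have [n] := ubnP #|E|; elim: n E => // n IH E ltEn leh.
have [/exists_inP[x Ex /forallP lehx]|] :=
  boolP [exists x in E, forall S : {set D}, \sum_(d in S) h d <= r (colored (E :\ x) S)].
  by apply: (IH (E :\ x)) => //; move: ltEn; rewrite (cardsD1 x E) Ex.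
rewrite negb_exists_in => /forall_inP minE.
have Eh d : #|colored E [set d]| <= h d.
  rewrite leqNgt; apply/negP => lthE.
  have coE x : x \in colored E [set d] -> exists2 S : {set D}, tight h E S && (d \in S) &
     r (colored E S :\ x) < r (colored E S).
    rewrite !inE => /andP[Ex /eqP xd].
    have := minE x Ex; rewrite negb_forall => /existsP[S]; rewrite -ltnNge => ltS.
    rewrite setIDAC in ltS; have leS := leh S.
    have Sd: d \in S.
      case: (boolP (d \in S)) => // nSd; move: ltS.
      rewrite (_ : colored E S :\ x = colored E S) ?ltnNge ?leS //.
      by apply/setP=> y; rewrite !inE; case: eqP => // ->; rewrite xd (negPf nSd) andbF.
    exists S; last by lia.
    (* Deleting x lowers the rank by at most [r [set x] <= 1], so a condition that breaks on this
       deletion was tight. *)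
    rewrite Sd andbT /tight eqn_leq leS andbT.
    have := r_submod (colored E S :\ x) [set x]; have := r_card [set x].
    have Sx : x \in colored E S by rewrite !inE Ex xd.
    by rewrite setUC setD1K // cards1; lia.
  have /card_gt0P[x0 Ex0] : 0 < #|colored E [set d]| by lia.
  have [S0 tS0 _] := coE x0 Ex0.
  have [S /andP[tS Sd] minS] :=
    @arg_minnP _ S0 (fun S => tight h E S && (d \in S)) (fun S => #|S|) tS0.
  have sES : colored E [set d] \subset colored E S by rewrite setIS // preimsetS // sub1set.
  have coES : {in colored E [set d], forall x, r (colored E S :\ x) < r (colored E S)}.
    move=> x Ex; have [S' /andP[tS' S'd] rS'] := coE x Ex.
    (* As [S :&: S'] is tight and contains d, minimality of S puts S inside S'; being a coloop
       passes down to the smaller set. *)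
    apply: rank_coloop_sub (subsetP sES x Ex) rS'.
    have /andP[_ tSS'] := tightUI leh tS tS'.
    have := minS (S :&: S'); rewrite tSS' inE Sd S'd => /(_ isT) leSS'.
    have sSS' : S \subset S' by apply/setIidPl/eqP; rewrite eqEcard subsetIl.
    by rewrite setIS // preimsetS.
  have := rank_coloops sES coES.
  have -> : colored E S :\: colored E [set d] = colored E (S :\ d).
    by apply/setP=> x; rewrite !inE; case: (x \in E); case: eqP.
  have := leh (S :\ d); move/eqP: tS; rewrite (big_setD1 d) //=; lia.
exists E; have Ehd d : #|colored E [set d]| = h d.
  by apply/eqP; rewrite eqn_leq Eh (leq_trans _ (r_card _)) // (leq_trans _ (leh _)) // big_set1.
split=> //; apply/eqP; rewrite eqn_leq r_card.
have := leh setT; rewrite preimsetT setIT; apply: leq_trans.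
by rewrite -{1}(setIT E) -(preimsetT col) card_color_sum leq_sum.
Qed.

(* Greedily raise g while the rank condition survives; once it is stuck, the
   colors below f are covered by tight sets, whose union is tight, so that
   the sum of g has reached k. *)
Lemma rado_transversal_bounds (g f : D -> nat) (k : nat) :
    (forall d, g d <= f d) -> \sum_d g d <= k ->
    (forall S : {set D}, \sum_(d in S) g d <= r (colored setT S)) ->
    (forall S : {set D}, k <= r (colored setT S) + \sum_(d in ~: S) f d) ->
  exists F : {set T}, [/\ independent F, #|F| = k &
    forall d, g d <= #|colored F [set d]| <= f d].
Proof.
have [n] := ubnP (k - \sum_d g d); elim: n g => // n IH g ltn legf.
rewrite leq_eqVlt => /predU1P[gk | ltgk] leg lef.
  have [F [Find Fg]] := rado_transversal leg.
  exists F; split=> // [|d]; last by rewrite Fg leqnn legf.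
  rewrite -gk -(setIT F) -(preimsetT col) card_color_sum.
  by apply: eq_big => // d; rewrite inE.
pose g' d0 d := g d + (d == d0).
have g'E d0 (S : {set D}) : \sum_(d in S) g' d0 d = \sum_(d in S) g d + (d0 \in S).
  rewrite big_split; congr (_ + _); case: (boolP (d0 \in S)) => Sd0.
    rewrite (big_setD1 d0) //= eqxx big1 // => d.
    by rewrite !inE => /andP[/negPf->].
  by rewrite big1 // => d Sd; case: eqP Sd0 => // <-; rewrite Sd.
have g'T d0 : \sum_d g' d0 d = (\sum_d g d).+1.
  have := g'E d0 setT; rewrite inE addn1.
  by under eq_bigl do rewrite inE; under [in RHS]eq_bigl do rewrite inE.
have [/existsP[d0 /andP[ltd0 /forallP leg']]|] := boolP
    [exists d0, (g d0 < f d0) &&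
      [forall S : {set D}, \sum_(d in S) g' d0 d <= r (colored setT S)]].
  have [||||F [Find Fk Fgf]] := IH (g' d0) _ _ _ _ lef => //.
  - by rewrite g'T; lia.
  - by move=> d; rewrite /g'; case: eqP => [->|_]; rewrite ?addn1 ?addn0.
  - by rewrite g'T.
  exists F; split=> // d; have /andP[leF ->] := Fgf d.
  by rewrite andbT (leq_trans _ leF) // leq_addr.
move=> /existsPn sat; exfalso.
pose U := \bigcup_(S | tight g setT S) S.
have tU : tight g setT U.
  apply: (big_ind (tight g setT)) => // [|S S' tS tS'].
    by rewrite /tight big_set0 preimset0 setI0; have := r_card set0; rewrite cards0; lia.
  by case/andP: (tightUI leg tS tS').
(* If g could grow at d within f, some S would break after the raise. It breaks by one only, so S is
   tight and contains d, which puts d in U. *)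
have fU d : d \in ~: U -> f d = g d.
  rewrite inE => nUd; apply/eqP; rewrite eqn_leq legf andbT leqNgt; apply/negP => ltd.
  have := sat d; rewrite ltd negb_forall => /existsP[S]; rewrite -ltnNge g'E => ltS.
  case/negP: nUd; apply/bigcupP; have := leg S.
  case: (boolP (d \in S)) ltS => [Sd ltS leS|_]; last by lia.
  by exists S => //; rewrite /tight; lia.
have := lef U; rewrite (eq_bigr _ fU) (eqP tU).
have -> : \sum_(d in ~: U) g d = \sum_(d | d \notin U) g d.
  by apply: eq_bigl => d; rewrite inE.
by rewrite leqNgt; rewrite (bigID (mem U)) /= in ltgk; rewrite ltgk.
Qed.

End MatroidRank.

(** * Counting components when an edge is added *)

Lemma set2_eq (T : finType) (x y u v : T) : x != y ->
  ([set u; v] == [set x; y]) = (u == x) && (v == y) || (u == y) && (v == x).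
Proof.
move=> neq_xy; apply/eqP/idP => [/setP uv|]; last first.
  by case/orP=> /andP[/eqP-> /eqP->] //; rewrite setUC.
have [ux|ux] := eqVneq u x.
  by have := uv y; rewrite !inE ux eqxx orbT (eq_sym y x) (negPf neq_xy) /= eq_sym => ->.
have := uv u; rewrite !inE eqxx (negPf ux) /= => <-.
by have := uv x; rewrite !inE eqxx eq_sym (negPf ux) /= eq_sym => ->.
Qed.

(** The edge xy can only merge the components of x and y. If these differ, [root e'] maps the
    e-roots other than that of y bijectively onto the e'-roots. *)
Lemma n_comp_add_edge (T : finType) (e e' : rel T) x y :
    connect_sym e -> connect_sym e' ->
    (forall u v, e' u v = [|| e u v, (u == x) && (v == y) | (u == y) && (v == x)]) ->
  n_comp e predT = n_comp e' predT + ~~ connect e x y.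
Proof.
move=> sym_e sym_e' e'E.
have sub_e : subrel (connect e) (connect e').
  by apply: connect_sub => u v euv; apply: connect1; rewrite e'E euv.
have e'xy : connect e' x y by apply: connect1; rewrite e'E !eqxx orbT.
(* Connectivity in e' in terms of e: the new edge is crossed never, or once in either direction. *)
pose c u v := [|| connect e u v, connect e u x && connect e y v | connect e u y && connect e x v].
have c_e' u v : connect e' u v -> c u v.
  case/connectP=> p; elim/last_ind: p v => [|p w IH] v /=.
    by move=> _ ->; rewrite /c connect0.
  rewrite rcons_path last_rcons => /andP[/IH] /(_ _ erefl) cu + ->.
  move: (last u p) cu => {IH} z cu.
  have ce := @connect_trans _ e.
  rewrite e'E => /or3P[/connect1 ezw | /andP[/eqP ? /eqP ?] | /andP[/eqP ? /eqP ?]]; subst.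
  - case/or3P: cu => [uz|/andP[ux yz]|/andP[uy xz]]; rewrite /c.
    + by rewrite (ce _ _ _ uz ezw).
    + by rewrite ux (ce _ _ _ yz ezw) orbT.
    + by rewrite uy (ce _ _ _ xz ezw) !orbT.
  - case/or3P: cu => [uz|/andP[ux yz]|/andP[uy xz]]; rewrite /c ?connect0 ?andbT.
    + by rewrite uz orbT.
    + by rewrite ux orbT.
    + by rewrite uy.
  - case/or3P: cu => [uz|/andP[ux yz]|/andP[uy xz]]; rewrite /c ?connect0 ?andbT.
    + by rewrite uz !orbT.
    + by rewrite ux.
    + by rewrite uy !orbT.
have [exy|nexy] := boolP (connect e x y).
  rewrite addn0; apply: eq_n_comp => u v; apply/idP/idP => [|/c_e']; first exact: sub_e.
  case/or3P=> // /andP[h1 h2]; apply: connect_trans h1 _; apply: connect_trans h2 => //.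
  by rewrite sym_e.
have rc (a : rel T) : n_comp a predT = #|[set z | roots a z]|.
  by rewrite cardsE; apply: eq_card => z; rewrite !inE andbT.
rewrite !rc (cardsD1 (root e y)) inE roots_root //= addnC; congr (_ + _).
set A := _ :\ _; have injA : {in A &, injective (root e')}.
  move=> u v; rewrite !inE => /andP[uy ru] /andP[vy rv] /eqP.
  rewrite root_connect // => /c_e'.
  have ny w : roots e w -> w != root e y -> connect e w y = false.
    move=> rw wy; apply: contraNF wy => wy.
    by rewrite -{1}(eqP rw) root_connect.
  rewrite /c (sym_e y v) (ny u) // (ny v) // andbF /= orbF.
  by rewrite -root_connect // (eqP ru) (eqP rv) => /eqP.
rewrite -(card_in_imset injA); congr #|pred_of_set _|; apply/setP=> z; rewrite inE.
apply/imsetP/idP => [[u _ ->]|rz]; first exact: roots_root.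
have rootK w : root e' (root e w) = root e' w.
  by apply/eqP; rewrite root_connect // sym_e'; apply/sub_e/connect_root.
(* An e'-root in the e-component of y comes from the e-root of x, because that of y was removed from
   [A]. *)
have [zy|zy] := eqVneq (root e z) (root e y); last first.
  exists (root e z); first by rewrite !inE zy roots_root.
  by rewrite rootK (eqP rz).
exists (root e x); first by rewrite !inE roots_root // root_connect // nexy.
rewrite rootK -(eqP rz) -(rootK z) zy rootK; apply/esym/eqP.
by rewrite root_connect.
Qed.

(** * The rank function of the graphic matroid *)

Section GraphRank.
Variables (V : finType) (C : Type) (G : ecgraph V C).
Implicit Types (F A B : {set edge G}) (e : edge G).

Local Notation adjF F := (adj (sub_sgraph F)).

Lemma adj_sym F : connect_sym (adjF F).
Proof. by apply: sym_connect_sym => x y; rewrite /adj /= setUC. Qed.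

Lemma adj_sub A B : A \subset B -> subrel (connect (adjF A)) (connect (adjF B)).
Proof.
move=> sAB; apply: connect_sub => x y /= /imsetP[e Ae exy].
by apply: connect1; rewrite /adj /= exy imset_f // (subsetP sAB).
Qed.

Lemma edge_ends e : exists x y, x != y /\ val e = [set x; y].
Proof.
exact/cards2P/eqP/(edges_card2 (valP e)).
Qed.

(** Ranging over all pairs in [val e] avoids choosing an order on the two ends. *)
Definition joined F e :=
  [forall x in val e, forall y in val e, connect (adjF F) x y].

Lemma joinedE F e x y : val e = [set x; y] -> joined F e = connect (adjF F) x y.
Proof.
move=> exy; have ends z : (z \in val e) = (z == x) || (z == y) by rewrite exy !inE.
apply/forall_inP/idP => [/(_ x)|cxy u].
  by rewrite ends eqxx => /(_ isT)/forall_inP; apply; rewrite ends eqxx orbT.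
rewrite ends => eu; apply/forall_inP => v; rewrite ends.
by case/orP: eu => /eqP-> /orP[]/eqP->; rewrite ?connect0 // adj_sym.
Qed.

Lemma joined_sub A B e : A \subset B -> joined A e -> joined B e.
Proof.
have [x [y [_ exy]]] := edge_ends e.
by move=> sAB; rewrite !(joinedE _ exy); apply: adj_sub.
Qed.

Lemma omega_setU1 F e :
  omega (sub_sgraph F) = omega (sub_sgraph (e |: F)) + ~~ joined F e.
Proof.
have [x [y [xy exy]]] := edge_ends e; rewrite (joinedE _ exy).
apply: n_comp_add_edge; try exact: adj_sym.
by move=> u v; rewrite /adj /= imsetU1 inE inE orbC exy set2_eq.
Qed.

Lemma omega_set0 : omega (sub_sgraph (set0 : {set edge G})) = #|V|.
Proof.
rewrite /omega /n_comp_mem; apply: eq_card => x; rewrite !inE andbT /roots.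
case/connectP: (connect_root (adjF (set0 : {set edge G})) x) => -[|y p] /=.
  by move=> _ ->; rewrite eqxx.
by rewrite {1}/adj /= imset0 inE.
Qed.

Lemma omega_le F : omega (sub_sgraph F) <= #|V|.
Proof. exact: max_card. Qed.

(** An edge that merges two components over the larger graph also does so over the smaller one, so
    adding D merges no more over B than over A. *)
Lemma omega_diminishing A B D : A \subset B ->
  omega (sub_sgraph B) + omega (sub_sgraph (A :|: D)) <=
  omega (sub_sgraph A) + omega (sub_sgraph (B :|: D)).
Proof.
move=> sAB; have [n] := ubnP #|D|; elim: n D => // n IH D ltDn.
have [->|[x Dx]] := set_0Vmem D; first by rewrite !setU0 addnC.
have := IH (D :\ x); rewrite (cardsD1 x D) Dx in ltDn; move=> /(_ ltDn).
rewrite (omega_setU1 (A :|: _) x) (omega_setU1 (B :|: _) x).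
rewrite !(setUCA [set x]) setD1K //.
have := @joined_sub (A :|: D :\ x) (B :|: D :\ x) x (setSU _ sAB).
by case: joined => [/(_ isT)->|_] /=; [|case: joined => /=]; lia.
Qed.

(** The number of edges of a maximal forest in F; by [omega_le] the subtraction never truncates. *)
Definition graph_rank F := #|V| - omega (sub_sgraph F).

(** This is [omega_diminishing] for [A :&: B] inside B, with the edges of A added to both. *)
Lemma graph_rank_submod A B :
  graph_rank (A :|: B) + graph_rank (A :&: B) <= graph_rank A + graph_rank B.
Proof.
have := omega_diminishing A (subsetIr A B).
rewrite (setUidPr (subsetIl A B)).
rewrite /graph_rank (setUC B).
have := omega_le (A :|: B); have := omega_le (A :&: B).
have := omega_le A; have := omega_le B.
lia.
Qed.

Lemma graph_rank_homo A B : A \subset B -> graph_rank A <= graph_rank B.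
Proof.
have [n] := ubnP #|B :\: A|; elim: n A => // n IH A ltn sAB.
have [BA|[e BAe]] := set_0Vmem (B :\: A).
  by rewrite (_ : A = B) //; apply/eqP; rewrite eqEsubset sAB -setD_eq0 BA eqxx.
move: (BAe); rewrite inE => /andP[_ Be].
have := IH (e |: A); rewrite subUset sub1set Be sAB => /(_ _ isT) leB.
apply: leq_trans (leB _); first by rewrite /graph_rank (omega_setU1 A e) leq_sub2l ?leq_addr.
by move: ltn; rewrite (cardsD1 e (B :\: A)) BAe setDDl (setUC A).
Qed.

Lemma graph_rank_card A : graph_rank A <= #|A|.
Proof.
rewrite leq_subLR; have [n] := ubnP #|A|; elim: n A => // n IH A ltAn.
have [->|[e Ae]] := set_0Vmem A; first by rewrite omega_set0 leq_addr.
rewrite (cardsD1 e A) Ae in ltAn *; have := IH _ ltAn.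
by rewrite (omega_setU1 _ e) setD1K //; case: joined; lia.
Qed.

Lemma graph_rank_D1 A e : e \in A ->
  (graph_rank (A :\ e) < graph_rank A) = ~~ joined (A :\ e) e.
Proof.
move=> Ae; have := omega_setU1 (A :\ e) e; rewrite setD1K // => oA.
by have := omega_le (A :\ e); rewrite /graph_rank; move: oA; case: joined => /=; lia.
Qed.

(** A simple path avoiding e between its ends closes up to a cycle with e; conversely, a cycle
    without its first edge still joins the ends of that edge. *)
Lemma acyclicP F :
  acyclic (sub_sgraph F) <-> {in F, forall e, ~~ joined (F :\ e) e}.
Proof.
split=> [acF e Fe|coF [|x [|y [|z p]]] //].
  have [x [y [xy exy]]] := edge_ends e; rewrite (joinedE _ exy).
  apply/negP => /connectP[p0 xp0 yp0]; case/shortenP: xp0 yp0 => p xp Up _ yp.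
  have adjs : subrel (adj (sub_sgraph (F :\ e))) (adj (sub_sgraph F)).
    by move=> u v /imsetP[e' + uv]; rewrite inE => /andP[_ Fe']; rewrite /adj /= uv imset_f.
  have /acF : ucycle (adj (sub_sgraph F)) (x :: p).
    rewrite /ucycle Up andbT /= rcons_path (sub_path adjs xp) /= -yp.
    by rewrite /adj /= setUC -exy imset_f.
  (* Acyclicity leaves at most one vertex in p: none would give x = y, and one would make e an edge
     of [F :\ e]. *)
  case: p yp xp {Up} => [|y' [|//]] /= yp; first by rewrite yp eqxx in xy.
  rewrite -yp andbT => /imsetP[e'].
  by rewrite -exy => /[!inE] /andP[/eqP ne _] /val_inj e'e; case: ne.
case/andP; rewrite [cycle _ _]/= => /and3P[/imsetP[e Fe exy] yz zp] Up.
have := coF e Fe; rewrite (joinedE _ (esym exy)) => /negP[].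
have val_e u v : [set u; v] \in [set val x | x in F] -> [set u; v] != val e ->
    adj (sub_sgraph (F :\ e)) u v.
  case/imsetP=> e' Fe' uv ne; rewrite /adj /= uv imset_f // !inE Fe' andbT.
  by apply: contraNneq ne => <-; rewrite uv.
move: Up; rewrite /= !inE !negb_or => /and4P[/and3P[xy xz xp] /andP[yz' yp] zp' Up].
(* Go the other way round the cycle: yz is not e because z differs from x, and the rest from z to x
   avoids y, hence e. *)
rewrite adj_sym; apply: (@connect_trans _ _ z).
  apply/connect1/val_e => //; rewrite -exy; apply: contraNneq xz => /setP/(_ z).
  by rewrite !inE eqxx orbT (eq_sym z y) (negPf yz') orbF eq_sym => /esym.
apply/connectP; exists (rcons p x); last by rewrite last_rcons.
have allp : all (predC1 y) (z :: rcons p x).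
  rewrite /= all_rcons /= eq_sym yz' xy /=.
  by apply/allP=> w pw /=; apply: contraNneq yp => <-.
apply: (sub_in_path _ allp zp) => u v; rewrite !inE => uy vy /val_e; apply.
rewrite -exy; apply/eqP=> /setP/(_ y); rewrite !inE eqxx orbT.
by rewrite eq_sym (negPf uy) eq_sym (negPf vy).
Qed.

Lemma forestP F : acyclic (sub_sgraph F) <-> independent graph_rank F.
Proof.
rewrite acyclicP (independentP graph_rank_card graph_rank_submod).
by split=> coF e Fe; have := coF e Fe; rewrite graph_rank_D1.
Qed.

End GraphRank.

(* Sums over possibly infinite color sets *)
From mathcomp Require Import all_order all_algebra.
From mathcomp Require Import boolp classical_sets reals ereal esum.
Import Order.TTheory GRing.Theory Num.Theory.

Local Open Scope ring_scope.
Local Open Scope ereal_scope.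

(** After exchanging the sums, each i contributes only at c = [p i], and only if this lies in R. *)
Lemma esum_preim (K : realType) (C : choiceType) (I : finType) (P : pred I)
    (p : I -> C) (w : I -> nat) (R : set C) :
  \esum_(c in R) (\sum_(i | P i && (p i == c)) w i)%N%:R%:E =
  (\sum_(i | P i && (p i \in R)) w i)%N%:R%:E :> \bar K.
Proof.
have w_ge0 i : 0 <= (w i)%:R%:E :> \bar K by rewrite lee_fin ler0n.
under eq_esum => c _ do
  rewrite natr_sum -sumEFin big_mkcondr /=.
rewrite esum_sum => [|c i _ _]; last by case: ifP.
rewrite natr_sum -sumEFin big_mkcondr /=; apply: eq_bigr => i _.
transitivity (\esum_(c in R `&` [set p i]) (w i)%:R%:E : \bar K).
  rewrite esum_mkcondr; apply: eq_esum => c _; congr (if _ then _ else _).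
  by rewrite eq_sym; apply/eqP/idP; rewrite inE.
case: ifPn => [Rp|/negP Rp].
  rewrite (_ : R `&` _ = [set p i])%classic ?esum_set1 //.
  by apply/seteqP; split=> c /=; [case|move=> ->; split=> //; apply/set_mem].
rewrite esum1 // => c [Rc /= cp]; case: Rp.
by apply/mem_set; rewrite -cp.
Qed.

Section EdgeColored.
Variables (V : finType) (C : choiceType) (G : ecgraph V C).

(** The edges of the subgraph and those of G form different types, so they are compared through
    their underlying vertex pairs. *)
Lemma card_edges_in (F : {set edge G}) (R : set C) :
  #|edges_in (spanning_subgraph F) R| = #|F :&: edges_in G R|.
Proof.
rewrite -(card_imset _ val_inj) -[RHS](card_imset _ val_inj).
apply: eq_card => x; apply/imsetP/imsetP => -[e].
  rewrite inE /= => Re ->; have /imsetP[e' Fe' ee'] := valP e.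
  exists e' => //; rewrite !inE Fe' /=.
  by rewrite (_ : e' = exist _ (val e) (sub_edges_in (valP e))) //; apply: val_inj.
rewrite !inE => /andP[Fe Re] ->.
have Fe' : val e \in [set val x | x in F] by rewrite imset_f.
exists (exist _ (val e) Fe') => //; rewrite inE /=.
by rewrite (_ : exist _ _ _ = e) //; apply: val_inj.
Qed.

Lemma esum_card_edges_in (K : realType) (F : {set edge G}) (R : set C) :
  \esum_(c in R) #|F :&: edges_in G [set c]|%:R%:E =
  #|F :&: edges_in G R|%:R%:E :> \bar K.
Proof.
have cardE S : #|F :&: edges_in G S| = (\sum_(e | (e \in F) && (color e \in S)) 1)%N.
  by rewrite sum1_card; apply: eq_card => e; rewrite !inE.
rewrite cardE -esum_preim; apply: eq_esum => c _; rewrite cardE.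
congr (_%:R%:E); apply: eq_bigl => e; congr (_ && _).
by apply/idP/eqP; rewrite inE.
Qed.

(** C may be infinite, whereas the matroid argument needs a finite type of colors. *)
Definition used_color : finType := seq_sub (codom (@color V C G)).

Definition edge_color (e : edge G) : used_color := SeqSub (codom_f (@color V C G) e).

Lemma esum_used_color (K : realType) (S : {set used_color}) (h : C -> nat) :
  \esum_(c in [set c | exists2 d, d \in S & val d = c]%classic) (h c)%:R%:E =
  (\sum_(d in S) h (val d))%N%:R%:E :> \bar K.
Proof.
set R := [set c | _]%classic.
rewrite (eq_bigl (fun d => (d \in S) && (val d \in R))); last first.
  move=> d; case: (boolP (d \in S)) => //= Sd.
  by apply/esym/mem_set; exists d.
rewrite -esum_preim; apply: eq_esum => c [d Sd <-].
congr (_%:R%:E); rewrite (big_pred1 d) // => d'.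
apply/andP/eqP => [[_ /eqP/val_inj]//|->]; by rewrite Sd.
Qed.

Lemma setD_edges_in (F : {set edge G}) (R : set C) :
  F :\: edges_in G R = F :&: edges_in G (~` R)%classic.
Proof. by apply/setP=> e; rewrite !inE in_setC andbC. Qed.

End EdgeColored.

(** * Chromatic spanning forests and the bounds on components *)

Theorem theorem2p2 (K : realType) (V : finType) (C : choiceType)
    (G : ecgraph V C) (g f : C -> nat) (m : nat)
    (le_gf : forall c : C, (g c <= f c)%N) (m_gt0 : (0 < m)%N)
    (le_mg : m%:R%:E + \esum_(c in [set: C]%classic) (g c)%:R%:E
               <= #|V|%:R%:E :> \bar K) :
  (exists F : {set edge G},
     [/\ is_spanning_forest F,
         chromatic g f (spanning_subgraph F)
       & omega (spanning_subgraph F) = m])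
  <->
  (forall R : set C,
     (omega (del_colors G R))%:R%:E <=
       mine (m%:R%:E + \esum_(c in R) (f c)%:R%:E)
            (#|V|%:R%:E - \esum_(c in (~` R)%classic) (g c)%:R%:E)
       :> \bar K).
Proof.
split=> [[F [/forestP Find chrF omF]] R|bound].
  have {}chrF c : (g c <= #|F :&: edges_in G [set c]| <= f c)%N.
    by rewrite -card_edges_in.
  (* The edges of F with color outside R form a forest in G minus the colors R, so that graph has at
     most [#|V| - #|F :\: edges_in G R|] components. Both bounds follow from this. *)
  have rFR : graph_rank (F :\: edges_in G R) = #|F :\: edges_in G R|.
    exact: independent_sub (@graph_rank_card V C G) (@graph_rank_submod V C G) _ _
      (finset.subsetDl F _) Find.
  have leR : (graph_rank (F :\: edges_in G R) <= graph_rank (~: edges_in G R))%N.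
    by apply: graph_rank_homo; rewrite finset.setDE subsetIr.
  rewrite rFR in leR.
  have /= leD := omega_le (~: edges_in G R).
  rewrite le_min; apply/andP; split.
    apply: (@le_trans _ _ (m%:R%:E + \esum_(c in R) #|F :&: edges_in G [set c]|%:R%:E)).
      rewrite esum_card_edges_in -EFinD lee_fin -natrD ler_nat -omF.
      have := omega_le F; move: leR Find; rewrite /independent /graph_rank.
      have := cardsID (edges_in G R) F; rewrite /del_colors /=; lia.
    apply: leeD2l; apply: le_esum => c _; rewrite lee_fin ler_nat.
    by case/andP: (chrF c).
  apply: (@le_trans _ _ (#|V|%:R%:E - \esum_(c in ~` R) #|F :&: edges_in G [set c]|%:R%:E)).
    rewrite esum_card_edges_in -setD_edges_in -EFinB lee_fin lerBrDr -natrD ler_nat.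
    move: leR; rewrite /graph_rank /del_colors /=; lia.
  apply: leeB => //; apply: le_esum => c _; rewrite lee_fin ler_nat.
  by case/andP: (chrF c).
pose R_ (S : {set used_color G}) : set C := [set c | exists2 d, d \in S & val d = c]%classic.
have R_E S e : (color e \in R_ S) = (edge_color e \in S).
  apply/idP/idP => [|Se]; last by apply/mem_set; exists (edge_color e).
  by rewrite inE => -[d Sd ed]; rewrite (_ : edge_color e = d) //; apply: val_inj.
have colE (S : {set used_color G}) :
    [set: edge G] :&: (@edge_color V C G) @^-1: S = edges_in G (R_ S).
  by apply/setP=> e; rewrite !inE /= R_E.
(* The first bound, with the used colors outside S deleted: exactly the edges with color in S
   remain. *)
have bound_f (S : {set used_color G}) :
    (#|V| - m <= graph_rank ([set: edge G] :&: (@edge_color V C G) @^-1: S)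
                 + \sum_(d in ~: S) f (val d))%N.
  rewrite colE; have := bound (R_ (~: S)); rewrite le_min => /andP[+ _].
  rewrite esum_used_color -EFinD lee_fin -natrD ler_nat.
  rewrite /del_colors (_ : ~: edges_in G _ = edges_in G (R_ S)); last first.
    by apply/setP=> e; rewrite !inE /= !R_E inE negbK.
  rewrite /graph_rank /=; lia.
(* The second bound at the complement of R. R ranges over all sets of colors with a finite sum, so
   that it also covers colors absent from G. *)
have bound_g (R : set C) (k : nat) : \esum_(c in R) (g c)%:R%:E = k%:R%:E :> \bar K ->
    (k <= graph_rank (edges_in G R))%N.
  move=> gk; have := bound (~` R)%classic; rewrite le_min => /andP[_].
  rewrite setCK gk -EFinB lee_fin lerBrDr -natrD ler_nat.
  rewrite /del_colors (_ : ~: edges_in G _ = edges_in G R) /graph_rank /=; first by lia.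
  by apply/setP=> e; rewrite !inE /= in_setC negbK.
have bound_gS (S : {set used_color G}) :
    (\sum_(d in S) g (val d) <= graph_rank ([set: edge G] :&: (@edge_color V C G) @^-1: S))%N.
  by rewrite colE; apply: bound_g; rewrite esum_used_color.
have le_gV : (m + \sum_d g (val (d : used_color G)) <= #|V|)%N.
  rewrite -(ler_nat K) -lee_fin natrD EFinD; apply: le_trans le_mg; apply: leeD2l.
  have := esum_used_color K [set: used_color G] g.
  under [X in _ = X%:R%:E]eq_bigl do rewrite inE.
  move<-; rewrite esum_mkcond; apply: le_esum => c _.
  by case: ifP => //; rewrite lee_fin ler0n.
have le_gk : (\sum_d g (val (d : used_color G)) <= #|V| - m)%N by lia.
have [F [Find Fk Fgf]] := rado_transversal_bounds
  (@graph_rank_card V C G) (@graph_rank_submod V C G)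
  (fun d => le_gf (val d)) le_gk bound_gS bound_f.
exists F; split=> [|c|]; first exact/forestP.
  rewrite card_edges_in; have [cG|cG] := boolP (c \in codom (@color V C G)).
    have := Fgf (SeqSub cG); rewrite (_ : F :&: _ = F :&: edges_in G [set c]%classic) //.
    apply/setP=> e; rewrite !inE; congr (_ && _).
    apply/eqP/idP => [/(congr1 val) ec|/set_mem ec]; last exact: val_inj.
    exact/mem_set.
  (* For a color on no edge, [bound_g] at this color alone gives [g c <= graph_rank set0], hence g c
     = 0. *)
  have edges0 : edges_in G [set c]%classic = finset.set0.
    apply/setP=> e; rewrite !inE; apply: contraNF cG => /set_mem /= <-.
    exact: codom_f.
  rewrite edges0 finset.setI0 cards0 /=.
  have := bound_g [set c]%classic (g c).
  rewrite edges0 esum_set1 ?lee_fin ?ler0n // => /(_ erefl).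
  have := graph_rank_card (finset.set0 : {set edge G}); rewrite cards0; lia.
(* F has rank [#|V| - m], and m is at most [#|V|] by [le_gV], so F has exactly m components. *)
have /= := omega_le F; move: Find le_gV; rewrite /independent Fk /graph_rank /=; lia.
Qed.
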